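(* Let $(\mathcal{C},\otimes,1)$ be a monoidal category which has equalizers and in which every object is flat. Let $\psi:C\to D$ be a morphism of coalgebras in $\mathcal{C}$. Then the following assertions are equivalent: (i) $\psi$ is a regular morphism of $D$-bicomodules in $\mathcal{C}$, i.e. there exists a $D$-bicomodule morphism $\chi:D\to C$ in $\mathcal{C}$ such that $\psi\circ\chi\circ\psi=\psi$; (ii) there is a $D$-bicomodule morphism $\chi:D\to C$ in $\mathcal{C}$ such that $\varepsilon_C\circ\chi\circ\psi=\varepsilon_C$. If one of these equivalent conditions holds, then (iii) the coinduction functor $\psi^*=-\square_D C:\mathcal{C}^D\to\mathcal{C}^C$ is semiseparable. Moreover, if the unit object $1$ of $\mathcal{C}$ is a left $\otimes$-cogenerator, then (iii) is equivalent to (i) and (ii).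
   Context: Associativity and unit constraints are suppressed. For a coalgebra $C$ in $\mathcal{C}$, $\Delta_C$ and $\varepsilon_C:C\to1$ are its comultiplication and counit, and $\mathcal{C}^C$ (resp. ${}^C\mathcal{C}$) is the category of right (resp. left) $C$-comodules in $\mathcal{C}$. An object $X$ is flat if both $X\otimes-$ and $-\otimes X$ preserve equalizers. For a right $C$-comodule $(V,\rho)$ and a left $C$-comodule $(W,\lambda)$, $e^C_{V,W}:V\square_C W\to V\otimes W$ is the equalizer of $\rho\otimes\mathrm{Id}_W$ and $\mathrm{Id}_V\otimes\lambda$. Given a coalgebra morphism $\psi:C\to D$, $C$ is a $D$-bicomodule via $(\psi\otimes\mathrm{Id}_C)\Delta_C$ and $(\mathrm{Id}_C\otimes\psi)\Delta_C$. The coinduction functor $\psi^*=-\square_D C:\mathcal{C}^D\to\mathcal{C}^C$ sends $M$ to $M\square_D C$ with right $C$-coaction $\rho$ uniquely determined by $(e^D_{M,C}\otimes\mathrm{Id}_C)\rho=(\mathrm{Id}_M\otimes\Delta_C)e^D_{M,C}$, and sends $f:M\to N$ to the unique morphism $f\square_D C$ with $e^D_{N,C}(f\square_D C)=(f\otimes\mathrm{Id}_C)e^D_{M,C}$. An object $Q$ is a left $\otimes$-cogenerator of $\mathcal{C}$ if for any morphisms $f,g:Y\to Z\otimes W$ in $\mathcal{C}$ with $(\xi\otimes\mathrm{Id}_W)f=(\xi\otimes\mathrm{Id}_W)g$ for every $\xi:Z\to Q$ in $\mathcal{C}$, one has $f=g$. A functor $F:\mathcal{A}\to\mathcal{B}$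 induces the natural transformation $\mathcal{F}:\mathrm{Hom}_{\mathcal{A}}(-,-)\to\mathrm{Hom}_{\mathcal{B}}(F-,F-)$, $f\mapsto F(f)$. $F$ is semiseparable if there is a natural transformation $\mathcal{P}:\mathrm{Hom}_{\mathcal{B}}(F-,F-)\to\mathrm{Hom}_{\mathcal{A}}(-,-)$ with $\mathcal{F}\circ\mathcal{P}\circ\mathcal{F}=\mathcal{F}$. *)

(* Defs.v *)
From Corelib Require Import ssreflect.
From Stdlib Require Import ProofIrrelevance IndefiniteDescription.

Set Implicit Arguments.
Unset Strict Implicit.
Unset Printing Implicit Defensive.

Declare Scope cat_scope.
Delimit Scope cat_scope with cat.
Open Scope cat_scope.

Record Category := {
  Ob :> Type;
  Hom : Ob -> Ob -> Type;
  idm : forall X, Hom X X;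
  comp : forall X Y Z, Hom Y Z -> Hom X Y -> Hom X Z;
  comp_idl : forall X Y (f : Hom X Y), comp (idm Y) f = f;
  comp_idr : forall X Y (f : Hom X Y), comp f (idm X) = f;
  comp_assoc : forall X Y Z T (h : Hom Z T) (g : Hom Y Z) (f : Hom X Y),
    comp h (comp g f) = comp (comp h g) f
}.
Arguments Hom {c} _ _.
Arguments idm {c} _.
Arguments comp {c X Y Z} _ _.

Notation "g ∘ f" := (comp g f) (at level 40, left associativity) : cat_scope.
Notation "'Id'" := (idm _) : cat_scope.

Record Functor (A B : Category) := {
  fob :> A -> B;
  fmap : forall X Y : A, Hom X Y -> Hom (fob X) (fob Y);
  fmap_id : forall X : A, fmap (idm X) = idm (fob X);
  fmap_comp : forall (X Y Z : A) (g : Hom Y Z) (f : Hom X Y),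
    fmap (g ∘ f) = fmap g ∘ fmap f
}.
Arguments fmap {A B} _ {X Y} _.

(* Naturality in both variables of a family Hom_B(F-,F-) -> Hom_A(-,-). *)
Definition natural_hom_back (A B : Category) (F : Functor A B)
    (P : forall X Y : A, Hom (F X) (F Y) -> Hom X Y) : Prop :=
  forall (X' X Y Y' : A) (h : Hom X' X) (k : Hom Y Y') (g : Hom (F X) (F Y)),
    P X' Y' (fmap F k ∘ g ∘ fmap F h) = k ∘ P X Y g ∘ h.

Definition semiseparable (A B : Category) (F : Functor A B) : Prop :=
  exists P : forall X Y : A, Hom (F X) (F Y) -> Hom X Y,
    natural_hom_back P /\
    forall (X Y : A) (f : Hom X Y), fmap F (P X Y (fmap F f)) = fmap F f.

Definition regular (A : Category) (X Y : A) (f : Hom X Y) : Prop :=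
  exists g : Hom Y X, f ∘ g ∘ f = f.

Definition is_equalizer (A : Category) (E X Y : A)
    (f g : Hom X Y) (e : Hom E X) : Prop :=
  f ∘ e = g ∘ e /\
  forall (T : A) (h : Hom T X), f ∘ h = g ∘ h -> exists! k : Hom T E, e ∘ k = h.

(* Equalizers are chosen, so that the cotensor product is a functor; nothing
   is assumed about the choice. *)
Record Equalizers (A : Category) := {
  eq_ob : forall (X Y : A) (f g : Hom X Y), A;
  eq_arr : forall (X Y : A) (f g : Hom X Y), Hom (eq_ob f g) X;
  eq_arrP : forall (X Y : A) (f g : Hom X Y), is_equalizer f g (eq_arr f g)
}.

Lemma lift_sig (A : Category) (E X Y T : A) (f g : Hom X Y) (e : Hom E X)
  (He : is_equalizer f g e) (h : Hom T X) (Hh : f ∘ h = g ∘ h) :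
  {k : Hom T E | e ∘ k = h}.
Proof.
apply: constructive_indefinite_description.
case: (proj2 He T h Hh) => k [Hk _]; by exists k.
Qed.

Definition eq_lift (A : Category) (E X Y T : A) (f g : Hom X Y) (e : Hom E X)
    (He : is_equalizer f g e) (h : Hom T X) (Hh : f ∘ h = g ∘ h) : Hom T E :=
  proj1_sig (lift_sig He Hh).

Lemma eq_liftE (A : Category) (E X Y T : A) (f g : Hom X Y) (e : Hom E X)
  (He : is_equalizer f g e) (h : Hom T X) (Hh : f ∘ h = g ∘ h) :
  e ∘ eq_lift He Hh = h.
Proof. exact: (proj2_sig (lift_sig He Hh)). Qed.

Lemma is_equalizer_mono (A : Category) (E X Y T : A) (f g : Hom X Y)
  (e : Hom E X) (He : is_equalizer f g e) (k l : Hom T E) :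
  e ∘ k = e ∘ l -> k = l.
Proof.
move=> Hkl.
have Hk : f ∘ (e ∘ k) = g ∘ (e ∘ k) by rewrite !comp_assoc (proj1 He).
case: (proj2 He T _ Hk) => m [_ Hm].
by rewrite -(Hm k) // -(Hm l).
Qed.

Record MonoidalCategory := {
  mcat :> Category;
  tens : mcat -> mcat -> mcat;
  tensm : forall X X' Y Y' : mcat,
    Hom X X' -> Hom Y Y' -> Hom (tens X Y) (tens X' Y');
  unitob : mcat;
  tensm_id : forall X Y : mcat, tensm (idm X) (idm Y) = idm (tens X Y);
  tensm_comp : forall (X X' X'' Y Y' Y'' : mcat) (f' : Hom X' X'')
    (f : Hom X X') (g' : Hom Y' Y'') (g : Hom Y Y'),
    tensm (f' ∘ f) (g' ∘ g) = tensm f' g' ∘ tensm f g;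
  assoc : forall X Y Z : mcat, Hom (tens (tens X Y) Z) (tens X (tens Y Z));
  associ : forall X Y Z : mcat, Hom (tens X (tens Y Z)) (tens (tens X Y) Z);
  lunit : forall X : mcat, Hom (tens unitob X) X;
  luniti : forall X : mcat, Hom X (tens unitob X);
  runit : forall X : mcat, Hom (tens X unitob) X;
  runiti : forall X : mcat, Hom X (tens X unitob);
  assocK : forall X Y Z : mcat, associ X Y Z ∘ assoc X Y Z = Id;
  associK : forall X Y Z : mcat, assoc X Y Z ∘ associ X Y Z = Id;
  lunitK : forall X : mcat, luniti X ∘ lunit X = Id;
  lunitiK : forall X : mcat, lunit X ∘ luniti X = Id;
  runitK : forall X : mcat, runiti X ∘ runit X = Id;
  runitiK : forall X : mcat, runit X ∘ runiti X = Id;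
  assoc_nat : forall (X X' Y Y' Z Z' : mcat)
    (f : Hom X X') (g : Hom Y Y') (h : Hom Z Z'),
    assoc X' Y' Z' ∘ tensm (tensm f g) h = tensm f (tensm g h) ∘ assoc X Y Z;
  lunit_nat : forall (X Y : mcat) (f : Hom X Y),
    lunit Y ∘ tensm (idm unitob) f = f ∘ lunit X;
  runit_nat : forall (X Y : mcat) (f : Hom X Y),
    runit Y ∘ tensm f (idm unitob) = f ∘ runit X;
  pentagon : forall X Y Z T : mcat,
    tensm (idm X) (assoc Y Z T) ∘ assoc X (tens Y Z) T
      ∘ tensm (assoc X Y Z) (idm T)
    = assoc X Y (tens Z T) ∘ assoc (tens X Y) Z T;
  triangle : forall X Y : mcat,
    tensm (idm X) (lunit Y) ∘ assoc X unitob Y = tensm (runit X) (idm Y)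
}.
Arguments tens {m} _ _.
Arguments tensm {m X X' Y Y'} _ _.
Arguments unitob {m}.
Arguments assoc {m} _ _ _.
Arguments associ {m} _ _ _.
Arguments lunit {m} _.
Arguments luniti {m} _.
Arguments runit {m} _.
Arguments runiti {m} _.

Notation "X ⊗ Y" := (tens X Y) (at level 38, left associativity) : cat_scope.
Notation "f ⊗m g" := (tensm f g) (at level 38, left associativity) : cat_scope.
Notation "'α'" := (assoc _ _ _) : cat_scope.
Notation "'α⁻¹'" := (associ _ _ _) : cat_scope.

Definition flat (C : MonoidalCategory) (X : C) : Prop :=
  forall (E Y Z : C) (f g : Hom Y Z) (e : Hom E Y), is_equalizer f g e ->
    is_equalizer (idm X ⊗m f) (idm X ⊗m g) (idm X ⊗m e) /\
    is_equalizer (f ⊗m idm X) (g ⊗m idm X) (e ⊗m idm X).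

Definition left_tensor_cogenerator (C : MonoidalCategory) (Q : C) : Prop :=
  forall (Y Z W : C) (f g : Hom Y (Z ⊗ W)),
    (forall xi : Hom Z Q, (xi ⊗m idm W) ∘ f = (xi ⊗m idm W) ∘ g) -> f = g.

Section MonoidalFacts.
Variable C : MonoidalCategory.

Lemma eq_pre (X Y Y' Z : C) (a : Hom Y Z) (b : Hom X Y) (c : Hom Y' Z)
  (d : Hom X Y') : a ∘ b = c ∘ d ->
  forall (T : C) (x : Hom T X), a ∘ (b ∘ x) = c ∘ (d ∘ x).
Proof. by move=> H T x; rewrite !comp_assoc H. Qed.

Lemma eq_pre1 (X Y Z : C) (a : Hom Y Z) (b : Hom X Y) (c : Hom X Z) :
  a ∘ b = c -> forall (T : C) (x : Hom T X), a ∘ (b ∘ x) = c ∘ x.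
Proof. by move=> H T x; rewrite !comp_assoc H. Qed.

Lemma assoc_mono (X Y Z T : C) (f g : Hom T (X ⊗ Y ⊗ Z)) :
  assoc X Y Z ∘ f = assoc X Y Z ∘ g -> f = g.
Proof.
move=> H; by rewrite -(comp_idl f) -(comp_idl g) -assocK -!comp_assoc H.
Qed.

Lemma associ_nat (X X' Y Y' Z Z' : C)
  (f : Hom X X') (g : Hom Y Y') (h : Hom Z Z') :
  associ X' Y' Z' ∘ (f ⊗m (g ⊗m h)) = ((f ⊗m g) ⊗m h) ∘ associ X Y Z.
Proof.
apply: assoc_mono.
by rewrite comp_assoc associK comp_idl (eq_pre (assoc_nat f g h)) associK comp_idr.
Qed.

Lemma tensm_idl (X Y Y' Y'' : C) (g : Hom Y' Y'') (f : Hom Y Y') :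
  (idm X ⊗m g) ∘ (idm X ⊗m f) = idm X ⊗m (g ∘ f).
Proof. by rewrite -tensm_comp comp_idl. Qed.

Lemma tensm_idr (X Y Y' Y'' : C) (g : Hom Y' Y'') (f : Hom Y Y') :
  (g ⊗m idm X) ∘ (f ⊗m idm X) = (g ∘ f) ⊗m idm X.
Proof. by rewrite -tensm_comp comp_idl. Qed.

Lemma tensm_lr (X X' Y Y' : C) (f : Hom X X') (g : Hom Y Y') :
  (f ⊗m Id) ∘ (Id ⊗m g) = f ⊗m g.
Proof. by rewrite -tensm_comp comp_idl comp_idr. Qed.

Lemma tensm_rl (X X' Y Y' : C) (f : Hom X X') (g : Hom Y Y') :
  (Id ⊗m g) ∘ (f ⊗m Id) = f ⊗m g.
Proof. by rewrite -tensm_comp comp_idl comp_idr. Qed.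

Lemma tensm_swap (X X' Y Y' : C) (f : Hom X X') (g : Hom Y Y') :
  (f ⊗m Id) ∘ (Id ⊗m g) = (Id ⊗m g) ∘ (f ⊗m Id).
Proof. by rewrite tensm_lr tensm_rl. Qed.

Lemma assoc_natl (X X' Y Z : C) (f : Hom X X') :
  assoc X' Y Z ∘ ((f ⊗m Id) ⊗m Id) = (f ⊗m Id) ∘ assoc X Y Z.
Proof. by rewrite assoc_nat tensm_id. Qed.

Lemma assoc_natr (X Y Z Z' : C) (h : Hom Z Z') :
  assoc X Y Z' ∘ (Id ⊗m h) = (Id ⊗m (Id ⊗m h)) ∘ assoc X Y Z.
Proof. by rewrite -tensm_id assoc_nat. Qed.

Lemma associ_natl (X X' Y Z : C) (f : Hom X X') :
  associ X' Y Z ∘ (f ⊗m Id) = ((f ⊗m Id) ⊗m Id) ∘ associ X Y Z.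
Proof. by rewrite -tensm_id associ_nat. Qed.

Lemma associ_natr (X Y Z Z' : C) (h : Hom Z Z') :
  associ X Y Z' ∘ (Id ⊗m (Id ⊗m h)) = (Id ⊗m h) ∘ associ X Y Z.
Proof. by rewrite associ_nat tensm_id. Qed.

Lemma tensm_unit_faithful (X Y : C) (f g : Hom X Y) :
  f ⊗m idm unitob = g ⊗m idm unitob -> f = g.
Proof.
move=> H; rewrite -(comp_idr f) -(comp_idr g) -(runitiK X) !comp_assoc.
by rewrite -!runit_nat H.
Qed.

Lemma runit_tens (X Y : C) :
  runit (X ⊗ Y) = (idm X ⊗m runit Y) ∘ assoc X Y unitob.
Proof.
apply: tensm_unit_faithful; apply: assoc_mono.
rewrite -triangle (eq_pre (assoc_natr _ _ _)) -pentagon.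
rewrite -!comp_assoc (eq_pre1 (tensm_idl _ _ _)) triangle.
by rewrite -tensm_idr (eq_pre (assoc_nat _ _ _)).
Qed.

End MonoidalFacts.

Record Coalgebra (C : MonoidalCategory) := {
  coalg_ob :> C;
  Delta : Hom coalg_ob (coalg_ob ⊗ coalg_ob);
  eps : Hom coalg_ob unitob;
  Delta_assoc : α ∘ (Delta ⊗m Id) ∘ Delta = (Id ⊗m Delta) ∘ Delta;
  Delta_epsl : lunit _ ∘ (eps ⊗m Id) ∘ Delta = Id;
  Delta_epsr : runit _ ∘ (Id ⊗m eps) ∘ Delta = Id
}.
Arguments Delta {C} _.
Arguments eps {C} _.

Record coalg_hom (C : MonoidalCategory) (A B : Coalgebra C) := {
  coalg_mor :> Hom A B;
  coalg_mor_Delta : Delta B ∘ coalg_mor = (coalg_mor ⊗m coalg_mor) ∘ Delta A;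
  coalg_mor_eps : eps B ∘ coalg_mor = eps A
}.

Definition is_rcoaction (C : MonoidalCategory) (D : Coalgebra C) (M : C)
    (rho : Hom M (M ⊗ D)) : Prop :=
  α ∘ (rho ⊗m Id) ∘ rho = (Id ⊗m Delta D) ∘ rho /\
  runit M ∘ (Id ⊗m eps D) ∘ rho = Id.

Definition is_lcoaction (C : MonoidalCategory) (D : Coalgebra C) (M : C)
    (lam : Hom M (D ⊗ M)) : Prop :=
  α ∘ (Delta D ⊗m Id) ∘ lam = (Id ⊗m lam) ∘ lam /\
  lunit M ∘ (eps D ⊗m Id) ∘ lam = Id.

Definition is_rcolinear (C : MonoidalCategory) (D : Coalgebra C) (M N : C)
    (rhoM : Hom M (M ⊗ D)) (rhoN : Hom N (N ⊗ D)) (f : Hom M N) : Prop :=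
  rhoN ∘ f = (f ⊗m Id) ∘ rhoM.

Definition is_lcolinear (C : MonoidalCategory) (D : Coalgebra C) (M N : C)
    (lamM : Hom M (D ⊗ M)) (lamN : Hom N (D ⊗ N)) (f : Hom M N) : Prop :=
  lamN ∘ f = (Id ⊗m f) ∘ lamM.

Record RComodule (C : MonoidalCategory) (D : Coalgebra C) := {
  rcomod_ob :> C;
  rcoact : Hom rcomod_ob (rcomod_ob ⊗ D);
  rcoactP : is_rcoaction rcoact
}.
Arguments rcoact {C D} _.

Record rcomod_hom (C : MonoidalCategory) (D : Coalgebra C)
    (M N : RComodule D) := {
  rcomod_mor :> Hom M N;
  rcomod_morP : is_rcolinear (rcoact M) (rcoact N) rcomod_mor
}.

Record Bicomodule (C : MonoidalCategory) (D D' : Coalgebra C) := {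
  bicomod_ob :> C;
  bilcoact : Hom bicomod_ob (D ⊗ bicomod_ob);
  bircoact : Hom bicomod_ob (bicomod_ob ⊗ D');
  bilcoactP : is_lcoaction bilcoact;
  bircoactP : is_rcoaction bircoact;
  bicoactP : α ∘ (bilcoact ⊗m Id) ∘ bircoact = (Id ⊗m bircoact) ∘ bilcoact
}.
Arguments bilcoact {C D D'} _.
Arguments bircoact {C D D'} _.

Record bicomod_hom (C : MonoidalCategory) (D D' : Coalgebra C)
    (M N : Bicomodule D D') := {
  bicomod_mor :> Hom M N;
  bicomod_morPl : is_lcolinear (bilcoact M) (bilcoact N) bicomod_mor;
  bicomod_morPr : is_rcolinear (bircoact M) (bircoact N) bicomod_mor
}.

Lemma rcomod_hom_eq (C : MonoidalCategory) (D : Coalgebra C)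
  (M N : RComodule D) (f g : rcomod_hom M N) :
  rcomod_mor f = rcomod_mor g -> f = g.
Proof.
case: f g => f Hf [g Hg] /= Efg; move: Hf; rewrite Efg => Hf.
by rewrite (proof_irrelevance _ Hf Hg).
Qed.

Lemma bicomod_hom_eq (C : MonoidalCategory) (D D' : Coalgebra C)
  (M N : Bicomodule D D') (f g : bicomod_hom M N) :
  bicomod_mor f = bicomod_mor g -> f = g.
Proof.
case: f g => f Hf Kf [g Hg Kg] /= Efg; move: Hf Kf; rewrite Efg => Hf Kf.
by rewrite (proof_irrelevance _ Hf Hg) (proof_irrelevance _ Kf Kg).
Qed.

Section ColinearFacts.
Variables (C : MonoidalCategory) (D : Coalgebra C).

Lemma is_rcolinear_id (M : C) (rho : Hom M (M ⊗ D)) : is_rcolinear rho rho Id.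
Proof. by rewrite /is_rcolinear tensm_id comp_idl comp_idr. Qed.

Lemma is_lcolinear_id (M : C) (lam : Hom M (D ⊗ M)) : is_lcolinear lam lam Id.
Proof. by rewrite /is_lcolinear tensm_id comp_idl comp_idr. Qed.

Lemma is_rcolinear_comp (M N P : C) (rM : Hom M (M ⊗ D)) (rN : Hom N (N ⊗ D))
  (rP : Hom P (P ⊗ D)) (g : Hom N P) (f : Hom M N) :
  is_rcolinear rN rP g -> is_rcolinear rM rN f -> is_rcolinear rM rP (g ∘ f).
Proof.
rewrite /is_rcolinear => Hg Hf.
by rewrite comp_assoc Hg -comp_assoc Hf comp_assoc tensm_idr.
Qed.

Lemma is_lcolinear_comp (M N P : C) (lM : Hom M (D ⊗ M)) (lN : Hom N (D ⊗ N))
  (lP : Hom P (D ⊗ P)) (g : Hom N P) (f : Hom M N) :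
  is_lcolinear lN lP g -> is_lcolinear lM lN f -> is_lcolinear lM lP (g ∘ f).
Proof.
rewrite /is_lcolinear => Hg Hf.
by rewrite comp_assoc Hg -comp_assoc Hf comp_assoc tensm_idl.
Qed.
End ColinearFacts.

Definition rcomod_cat (C : MonoidalCategory) (D : Coalgebra C) : Category.
Proof.
refine {|
  Ob := RComodule D;
  Hom := @rcomod_hom C D;
  idm := fun M => {| rcomod_mor := idm M;
    rcomod_morP := is_rcolinear_id (rcoact M) |};
  comp := fun M N P g f => {| rcomod_mor := rcomod_mor g ∘ rcomod_mor f;
    rcomod_morP := is_rcolinear_comp (rcomod_morP g) (rcomod_morP f) |} |}.
- by move=> M N f; apply: rcomod_hom_eq; exact: comp_idl.
- by move=> M N f; apply: rcomod_hom_eq; exact: comp_idr.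
- by move=> M N P Q h g f; apply: rcomod_hom_eq; exact: comp_assoc.
Defined.

Definition bicomod_cat (C : MonoidalCategory) (D D' : Coalgebra C) : Category.
Proof.
refine {|
  Ob := Bicomodule D D';
  Hom := @bicomod_hom C D D';
  idm := fun M => {| bicomod_mor := idm M;
    bicomod_morPl := is_lcolinear_id (bilcoact M);
    bicomod_morPr := is_rcolinear_id (bircoact M) |};
  comp := fun M N P g f => {| bicomod_mor := bicomod_mor g ∘ bicomod_mor f;
    bicomod_morPl := is_lcolinear_comp (bicomod_morPl g) (bicomod_morPl f);
    bicomod_morPr := is_rcolinear_comp (bicomod_morPr g) (bicomod_morPr f) |} |}.
- by move=> M N f; apply: bicomod_hom_eq; exact: comp_idl.
- by move=> M N f; apply: bicomod_hom_eq; exact: comp_idr.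
- by move=> M N P Q h g f; apply: bicomod_hom_eq; exact: comp_assoc.
Defined.

Section Along.
Variable C : MonoidalCategory.

Lemma is_lcoaction_Delta (D : Coalgebra C) : is_lcoaction (Delta D).
Proof. by split; [exact: Delta_assoc | exact: Delta_epsl]. Qed.

Lemma is_rcoaction_Delta (D : Coalgebra C) : is_rcoaction (Delta D).
Proof. by split; [exact: Delta_assoc | exact: Delta_epsr]. Qed.

Definition bicomod_self (D : Coalgebra C) : Bicomodule D D :=
  {| bilcoact := Delta D;
     bircoact := Delta D;
     bilcoactP := is_lcoaction_Delta D;
     bircoactP := is_rcoaction_Delta D;
     bicoactP := Delta_assoc D |}.

Variables (A D : Coalgebra C) (psi : coalg_hom A D).

Definition lcoact_along : Hom A (D ⊗ A) := (psi ⊗m Id) ∘ Delta A.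
Definition rcoact_along : Hom A (A ⊗ D) := (Id ⊗m psi) ∘ Delta A.

Lemma Delta_assoc' : α ∘ ((Delta A ⊗m Id) ∘ Delta A) = (Id ⊗m Delta A) ∘ Delta A.
Proof. by rewrite comp_assoc Delta_assoc. Qed.

Lemma lcoact_alongP : is_lcoaction lcoact_along.
Proof.
rewrite /is_lcoaction /lcoact_along; split; rewrite -!comp_assoc.
  rewrite (eq_pre1 (tensm_idr _ _ _)) coalg_mor_Delta -tensm_idr -!comp_assoc.
  rewrite (eq_pre (assoc_nat _ _ _)) Delta_assoc'.
  rewrite !comp_assoc; congr (_ ∘ _).
  by rewrite -!tensm_comp !comp_idl !comp_idr.
by rewrite (eq_pre1 (tensm_idr _ _ _)) coalg_mor_eps comp_assoc Delta_epsl.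
Qed.

Lemma rcoact_alongP : is_rcoaction rcoact_along.
Proof.
rewrite /is_rcoaction /rcoact_along; split; rewrite -!comp_assoc.
  rewrite (eq_pre1 (tensm_idl _ _ _)) coalg_mor_Delta -tensm_idl -!comp_assoc.
  rewrite -Delta_assoc' -(eq_pre (assoc_nat _ _ _)).
  congr (_ ∘ _); rewrite !comp_assoc; congr (_ ∘ _).
  by rewrite -!tensm_comp !comp_idl !comp_idr.
by rewrite (eq_pre1 (tensm_idl _ _ _)) coalg_mor_eps comp_assoc Delta_epsr.
Qed.

Lemma bicoact_alongP :
  α ∘ (lcoact_along ⊗m Id) ∘ rcoact_along
  = (Id ⊗m rcoact_along) ∘ lcoact_along.
Proof.
rewrite /rcoact_along /lcoact_along -tensm_idr -tensm_idl -!comp_assoc.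
rewrite (eq_pre (assoc_nat _ _ _)) (eq_pre (tensm_swap _ _)).
rewrite (eq_pre (assoc_natr _ _ _)) Delta_assoc'.
rewrite !comp_assoc; congr (_ ∘ _).
by rewrite -!tensm_comp !comp_idl !comp_idr.
Qed.

Definition bicomod_along : Bicomodule D D :=
  {| bilcoact := lcoact_along;
     bircoact := rcoact_along;
     bilcoactP := lcoact_alongP;
     bircoactP := rcoact_alongP;
     bicoactP := bicoact_alongP |}.

Lemma along_lcolinear : is_lcolinear lcoact_along (Delta D) psi.
Proof.
by rewrite /is_lcolinear /lcoact_along comp_assoc tensm_rl coalg_mor_Delta.
Qed.

Lemma along_rcolinear : is_rcolinear rcoact_along (Delta D) psi.
Proof.
by rewrite /is_rcolinear /rcoact_along comp_assoc tensm_lr coalg_mor_Delta.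
Qed.

Definition bicomod_along_hom : bicomod_hom bicomod_along (bicomod_self D) :=
  @Build_bicomod_hom C D D bicomod_along (bicomod_self D)
    psi along_lcolinear along_rcolinear.
End Along.

Section Cotensor.
Variables (C : MonoidalCategory) (E : Equalizers C) (D : Coalgebra C).
Variables (V W : C) (rho : Hom V (V ⊗ D)) (lam : Hom W (D ⊗ W)).

Definition cotens_l : Hom (V ⊗ W) (V ⊗ (D ⊗ W)) := α ∘ (rho ⊗m Id).
Definition cotens_r : Hom (V ⊗ W) (V ⊗ (D ⊗ W)) := Id ⊗m lam.
Definition cotens : C := eq_ob E cotens_l cotens_r.
Definition cotens_arr : Hom cotens (V ⊗ W) := eq_arr E cotens_l cotens_r.

Lemma cotens_arrP : is_equalizer cotens_l cotens_r cotens_arr.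
Proof. exact: eq_arrP. Qed.

Lemma cotens_arr_eq :
  α ∘ ((rho ⊗m Id) ∘ cotens_arr) = (Id ⊗m lam) ∘ cotens_arr.
Proof. by rewrite comp_assoc; exact: (proj1 cotens_arrP). Qed.
End Cotensor.

Section Coinduction.
Variables (C : MonoidalCategory) (E : Equalizers C).
Hypothesis C_flat : forall X : C, flat X.
Variables (A D : Coalgebra C) (psi : coalg_hom A D).

Section OnObjects.
Variable M : RComodule D.

Definition coind_ob : C := cotens E (rcoact M) (lcoact_along psi).
Definition coind_arr : Hom coind_ob (M ⊗ A) :=
  cotens_arr E (rcoact M) (lcoact_along psi).

Lemma coind_arr_tensP (X : C) :
  is_equalizer (cotens_l A (rcoact M) ⊗m idm X)
    (cotens_r M (lcoact_along psi) ⊗m idm X) (coind_arr ⊗m idm X).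
Proof. exact: (proj2 (C_flat X (cotens_arrP E _ _))). Qed.

Lemma coind_arr_eq :
  α ∘ ((rcoact M ⊗m Id) ∘ coind_arr) = (Id ⊗m lcoact_along psi) ∘ coind_arr.
Proof. exact: cotens_arr_eq. Qed.

Lemma lcoact_along_Delta :
  α ∘ ((lcoact_along psi ⊗m Id) ∘ Delta A) = (Id ⊗m Delta A) ∘ lcoact_along psi.
Proof.
rewrite /lcoact_along -tensm_idr -!comp_assoc (eq_pre (assoc_natl _ _ _)).
by rewrite Delta_assoc' !comp_assoc tensm_swap.
Qed.

Lemma tensm_assoc_mono (X Y Z T U : C) (f g : Hom U (X ⊗ (Y ⊗ Z ⊗ T))) :
  (idm X ⊗m assoc Y Z T) ∘ f = (idm X ⊗m assoc Y Z T) ∘ g -> f = g.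
Proof.
move=> H; rewrite -(comp_idl f) -(comp_idl g) -tensm_id -assocK -tensm_idl.
by rewrite -!comp_assoc H.
Qed.

Lemma coind_coact_wd :
  (cotens_l A (rcoact M) ⊗m idm A) ∘ (α⁻¹ ∘ (Id ⊗m Delta A) ∘ coind_arr)
  = (cotens_r M (lcoact_along psi) ⊗m idm A)
      ∘ (α⁻¹ ∘ (Id ⊗m Delta A) ∘ coind_arr).
Proof.
rewrite /cotens_l /cotens_r; apply: assoc_mono; apply: tensm_assoc_mono.
rewrite -tensm_idr -!comp_assoc.
have -> : forall (U : C) (f : Hom U (M ⊗ D ⊗ A ⊗ A)),
    (idm M ⊗m assoc D A A) ∘ (assoc M (D ⊗ A) A ∘ ((assoc M D A ⊗m idm A) ∘ f))
    = assoc M D (A ⊗ A) ∘ (assoc (M ⊗ D) A A ∘ f).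
  by move=> U f; rewrite !comp_assoc pentagon.
rewrite (eq_pre (assoc_natl _ _ _)) (eq_pre1 (associK _ _ _)) comp_idl.
rewrite (eq_pre (tensm_swap _ _)) (eq_pre (assoc_natr _ _ _)) coind_arr_eq.
rewrite (eq_pre (assoc_nat _ _ _)) (eq_pre1 (associK _ _ _)) comp_idl.
by rewrite !(eq_pre1 (tensm_idl _ _ _)) -comp_assoc lcoact_along_Delta.
Qed.

(* Unique with property coind_coactE, since coind_arr ⊗m Id is an equalizer. *)
Definition coind_coact : Hom coind_ob (coind_ob ⊗ A) :=
  eq_lift (coind_arr_tensP A) coind_coact_wd.

Lemma coind_coactE :
  (coind_arr ⊗m Id) ∘ coind_coact = α⁻¹ ∘ (Id ⊗m Delta A) ∘ coind_arr.
Proof. exact: eq_liftE. Qed.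

Lemma coind_coactP : is_rcoaction coind_coact.
Proof.
have HE : (coind_arr ⊗m Id) ∘ coind_coact
          = α⁻¹ ∘ ((Id ⊗m Delta A) ∘ coind_arr).
  by rewrite coind_coactE comp_assoc.
split; rewrite -!comp_assoc.
  apply: (is_equalizer_mono (coind_arr_tensP _)); apply: assoc_mono.
  rewrite -(eq_pre (assoc_natl _ _ _)) (eq_pre1 (tensm_idr _ _ _)) HE.
  rewrite -!tensm_idr -!comp_assoc HE.
  rewrite (eq_pre (tensm_swap _ _)) HE.
  rewrite (eq_pre (assoc_natr _ _ _)) (eq_pre1 (associK _ _ _)) comp_idl.
  rewrite (eq_pre1 (tensm_idl _ _ _)) -Delta_assoc' -!tensm_idl -!comp_assoc.
  have -> : forall (U : C) (f : Hom U (M ⊗ (A ⊗ A) ⊗ A)),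
      assoc M A (A ⊗ A) ∘ (assoc (M ⊗ A) A A ∘ ((associ M A A ⊗m idm A) ∘ f))
      = (idm M ⊗m assoc A A A) ∘ (assoc M (A ⊗ A) A ∘ f).
    move=> U f; rewrite !comp_assoc -pentagon.
    rewrite -(comp_assoc _ (assoc M A A ⊗m idm A)) tensm_idr associK tensm_id.
    by rewrite comp_idr.
  by rewrite (eq_pre (assoc_nat _ _ _)) (eq_pre1 (associK _ _ _)) comp_idl.
apply: (is_equalizer_mono (cotens_arrP E _ _)); rewrite comp_idr.
rewrite -/coind_arr -(eq_pre (runit_nat _)) (eq_pre (tensm_swap _ _)) HE.
rewrite runit_tens -!comp_assoc (eq_pre (assoc_natr _ _ _)).
rewrite (eq_pre1 (associK _ _ _)) comp_idl !(eq_pre1 (tensm_idl _ _ _)).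
by rewrite Delta_epsr tensm_id comp_idl.
Qed.

Definition coind_rcomod : RComodule A :=
  {| rcomod_ob := coind_ob; rcoact := coind_coact; rcoactP := coind_coactP |}.
End OnObjects.

Section OnMorphisms.
Variables (M N : RComodule D) (f : rcomod_hom M N).

Lemma coind_map_wd :
  cotens_l A (rcoact N) ∘ ((f ⊗m idm A) ∘ coind_arr M)
  = cotens_r N (lcoact_along psi) ∘ ((f ⊗m idm A) ∘ coind_arr M).
Proof.
rewrite /cotens_l /cotens_r -!comp_assoc (eq_pre1 (tensm_idr _ _ _)).
rewrite rcomod_morP -tensm_idr -!comp_assoc (eq_pre (assoc_natl _ _ _)).
by rewrite coind_arr_eq -(eq_pre (tensm_swap _ _)).
Qed.

Definition coind_map : Hom (coind_ob M) (coind_ob N) :=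
  eq_lift (cotens_arrP E (rcoact N) (lcoact_along psi)) coind_map_wd.

Lemma coind_mapE : coind_arr N ∘ coind_map = (f ⊗m Id) ∘ coind_arr M.
Proof. exact: eq_liftE. Qed.

Lemma coind_mapP : is_rcolinear (coind_coact M) (coind_coact N) coind_map.
Proof.
apply: (is_equalizer_mono (coind_arr_tensP N A)).
rewrite comp_assoc coind_coactE -!comp_assoc coind_mapE.
rewrite (eq_pre1 (tensm_idr _ _ _)) coind_mapE -tensm_idr -comp_assoc coind_coactE.
rewrite -!comp_assoc -(eq_pre (tensm_swap _ _)).
by rewrite (eq_pre (associ_natl _ _ _)).
Qed.

Definition coind_hom : rcomod_hom (coind_rcomod M) (coind_rcomod N) :=
  @Build_rcomod_hom C A (coind_rcomod M) (coind_rcomod N) coind_map coind_mapP.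
End OnMorphisms.

Definition coinduction : Functor (rcomod_cat D) (rcomod_cat A).
Proof.
refine (@Build_Functor (rcomod_cat D) (rcomod_cat A)
  coind_rcomod coind_hom _ _).
- move=> M; apply: rcomod_hom_eq.
  apply: (is_equalizer_mono (cotens_arrP E _ _)).
  by rewrite [LHS]coind_mapE /= tensm_id comp_idl comp_idr.
- move=> M N P g f; apply: rcomod_hom_eq.
  apply: (is_equalizer_mono (cotens_arrP E _ _)).
  rewrite [LHS]coind_mapE /= comp_assoc [X in _ = X ∘ _]coind_mapE.
  by rewrite -comp_assoc coind_mapE comp_assoc tensm_idr.
Defined.
End Coinduction.

(* Main.v *)
(* For (ii) => (i), psi chi psi and psi are left colinear maps into D with the
   same composite with the counit.

   For (ii) => (iii), Id_M ⊗ chi induces a natural D-colinear map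
   s_M : M -> M □ A, the counit of A a natural D-colinear map p_M : M □ A -> M,
   and P g := p_N g s_M. Although p_M s_M need not be the identity, its
   coinduction is, because e_M equalizes rho_M ⊗ Id and Id ⊗ lambda_A.

   For (iii) => (ii), chi := P g, where g is the composite D □ A ≅ A -> A □ A
   with last map induced by Delta_A. Naturality along psi : A -> D shows that
   psi chi is coinduced to the identity of D □ A, whence psi chi psi = psi. Any
   xi : D -> 1 acts on every D-bicomodule by the right colinear endomorphism
   (xi ⊗ Id) lambda; naturality along these shows that chi commutes with the
   actions, which is left colinearity when 1 is a left ⊗-cogenerator. *)
Require Import Defs.
From Corelib Require Import ssreflect.

Set Implicit Arguments.
Unset Strict Implicit.
Unset Printing Implicit Defensive.

(** * Coherence of the left unit constraint *)

Section Coherence.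
Variable C : MonoidalCategory.

Lemma assoc_epi (X Y Z T : C) (f g : Hom (X ⊗ (Y ⊗ Z)) T) :
  f ∘ assoc X Y Z = g ∘ assoc X Y Z -> f = g.
Proof. by move=> H; rewrite -(comp_idr f) -(comp_idr g) -associK !comp_assoc H. Qed.

Lemma assoc_tensm_epi (X Y Z T U : C) (f g : Hom (X ⊗ (Y ⊗ Z) ⊗ T) U) :
  f ∘ (assoc X Y Z ⊗m idm T) = g ∘ (assoc X Y Z ⊗m idm T) -> f = g.
Proof.
move=> H; rewrite -(comp_idr f) -(comp_idr g) -tensm_id -associK -tensm_idr.
by rewrite !comp_assoc H.
Qed.

Lemma unit_tensm_faithful (X Y : C) (f g : Hom X Y) :
  idm unitob ⊗m f = idm unitob ⊗m g -> f = g.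
Proof.
move=> H; rewrite -(comp_idr f) -(comp_idr g) -(lunitiK X) !comp_assoc.
by rewrite -!lunit_nat H.
Qed.

(** Kelly's argument: tensoring with the unit is faithful and associators are epi, so the claim may
    be tested where pentagon and triangle decide it. *)
Lemma lunit_tens (X Y : C) :
  lunit (X ⊗ Y) ∘ assoc unitob X Y = lunit X ⊗m idm Y.
Proof.
apply: unit_tensm_faithful; apply: assoc_epi; apply: assoc_tensm_epi.
rewrite -tensm_idl -!comp_assoc (comp_assoc _ (assoc _ _ _) (_ ⊗m _)) pentagon.
rewrite (eq_pre1 (triangle _ _)) -assoc_natl -triangle -tensm_idr.
by rewrite (eq_pre (assoc_nat _ _ _)).
Qed.

Lemma lunit_associ (X Y : C) :
  (lunit X ⊗m idm Y) ∘ associ unitob X Y = lunit (X ⊗ Y).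
Proof. by rewrite -lunit_tens -comp_assoc associK comp_idr. Qed.

End Coherence.

(** * Left colinear maps into a coalgebra *)

Section Counit.
Variables (C : MonoidalCategory) (D : Coalgebra C).

(* D is the cofree left D-comodule on the unit object. *)
Lemma lcolinear_eps (M : C) (lam : Hom M (D ⊗ M)) (f g : Hom M D) :
  is_lcolinear lam (Delta D) f -> is_lcolinear lam (Delta D) g ->
  eps D ∘ f = eps D ∘ g -> f = g.
Proof.
rewrite /is_lcolinear => Hf Hg Hfg.
rewrite -(comp_idl f) -(comp_idl g) -Delta_epsr -!comp_assoc Hf Hg.
by rewrite !(eq_pre1 (tensm_idl _ _ _)) Hfg.
Qed.

End Counit.

(** * The action of functionals [D -> 1] on left comodules *)

Section DualAction.
Variables (C : MonoidalCategory) (D : Coalgebra C).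

(** In Sweedler notation, m ↦ ξ(m_(-1)) m_(0). *)
Definition dual_act (M : C) (lam : Hom M (D ⊗ M)) (xi : Hom D unitob) : Hom M M :=
  lunit M ∘ (xi ⊗m Id) ∘ lam.

(** The action touches only the left leg, and the bicomodule compatibility lets [rho] pass through
    [lam]. *)
Lemma dual_act_rcolinear (D' : Coalgebra C) (M : C) (lam : Hom M (D ⊗ M))
  (rho : Hom M (M ⊗ D')) (xi : Hom D unitob) :
  α ∘ ((lam ⊗m Id) ∘ rho) = (Id ⊗m rho) ∘ lam ->
  is_rcolinear rho rho (dual_act lam xi).
Proof.
move=> H; rewrite /is_rcolinear /dual_act -!comp_assoc -(eq_pre (lunit_nat _)).
rewrite -(eq_pre (tensm_swap _ _)) -H -(eq_pre (assoc_natl _ _ _)).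
by rewrite (eq_pre1 (lunit_tens _ _)) !(eq_pre1 (tensm_idr _ _ _)) -comp_assoc.
Qed.

Lemma dual_act_nat (M N : C) (lamM : Hom M (D ⊗ M)) (lamN : Hom N (D ⊗ N))
  (f : Hom M N) (xi : Hom D unitob) :
  is_lcolinear lamM lamN f -> dual_act lamN xi ∘ f = f ∘ dual_act lamM xi.
Proof.
rewrite /is_lcolinear /dual_act => H.
by rewrite -!comp_assoc H (eq_pre (tensm_swap _ _)) (eq_pre (lunit_nat _)).
Qed.

(** Cancelling [lunit N] leaves the left colinearity equation composed with [xi ⊗m Id]; the
    cogenerator property removes [xi]. *)
Lemma lcolinear_of_dual_act (M N : C) (lamM : Hom M (D ⊗ M))
  (lamN : Hom N (D ⊗ N)) (f : Hom M N) :
  left_tensor_cogenerator (@unitob C) ->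
  (forall xi, dual_act lamN xi ∘ f = f ∘ dual_act lamM xi) ->
  is_lcolinear lamM lamN f.
Proof.
move=> Hcog Hf; apply: Hcog => xi; have := Hf xi; rewrite /dual_act.
rewrite -!comp_assoc (eq_pre (tensm_swap _ _)) -(eq_pre (lunit_nat _)) => H.
by rewrite -(comp_idl (_ ∘ _)) -(lunitK N) -comp_assoc H !comp_assoc lunitK comp_idl.
Qed.

End DualAction.

(** * Equivalence of (i) and (ii) *)

Section Regular.
Variables (C : MonoidalCategory) (A D : Coalgebra C) (psi : coalg_hom A D).

Lemma regular_iff_eps :
  @regular (bicomod_cat D D) (bicomod_along psi) (bicomod_self D)
    (bicomod_along_hom psi) <->
  exists chi : bicomod_hom (bicomod_self D) (bicomod_along psi),
    eps A ∘ chi ∘ psi = eps A.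
Proof.
split=> -[chi Hchi]; exists chi.
  have {}Hchi : psi ∘ chi ∘ psi = psi := f_equal (@bicomod_mor _ _ _ _ _) Hchi.
  by rewrite -{1}(coalg_mor_eps psi) -!comp_assoc (comp_assoc psi) Hchi
    coalg_mor_eps.
apply: bicomod_hom_eq.
apply: (@lcolinear_eps _ _ _ (lcoact_along psi)).
- exact: is_lcolinear_comp
    (is_lcolinear_comp (along_lcolinear psi) (bicomod_morPl chi))
    (along_lcolinear psi).
- exact: along_lcolinear.
- by rewrite /= !comp_assoc coalg_mor_eps.
Qed.

End Regular.

(** * The counit of coinduction *)

Section Semiseparable.
Variables (C : MonoidalCategory) (E : Equalizers C).
Hypothesis C_flat : forall X : C, flat X.
Variables (A D : Coalgebra C) (psi : coalg_hom A D).

Notation F := (coinduction E C_flat psi).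
Notation e := (coind_arr E psi).
Notation coact := (coind_coact E C_flat psi).

Lemma coact_arr (M : RComodule D) :
  assoc M A A ∘ ((e M ⊗m Id) ∘ coact M) = (Id ⊗m Delta A) ∘ e M.
Proof. by rewrite coind_coactE -comp_assoc (eq_pre1 (associK _ _ _)) comp_idl. Qed.

(** The map p_M: the counit of the adjunction between corestriction along [psi] and coinduction. *)
Definition coind_counit (M : RComodule D) : Hom (coind_ob E psi M) M :=
  runit M ∘ (Id ⊗m eps A) ∘ e M.

(** On M □ A the coaction of M equals the left coaction (ψ ⊗ Id)Δ of A; applying ε_A to the last leg
    leaves ψ. *)
Lemma rcoact_coind_counit (M : RComodule D) :
  rcoact M ∘ coind_counit M = (Id ⊗m psi) ∘ e M.
Proof.
rewrite /coind_counit -!comp_assoc -(eq_pre (runit_nat _)).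
rewrite (eq_pre (tensm_swap _ _)) runit_tens -!comp_assoc.
rewrite (eq_pre (assoc_natr _ _ _)) coind_arr_eq.
rewrite !(eq_pre1 (tensm_idl _ _ _)) /lcoact_along.
rewrite -(comp_assoc (runit D)) -(eq_pre (tensm_swap _ _)) (eq_pre (runit_nat _)).
by rewrite (comp_assoc (runit A)) Delta_epsr comp_idr.
Qed.

Lemma coind_counit_coact (M : RComodule D) :
  (coind_counit M ⊗m Id) ∘ coact M = e M.
Proof.
rewrite /coind_counit -!tensm_idr -!comp_assoc coind_coactE -triangle -!comp_assoc.
rewrite (eq_pre (assoc_nat _ _ _)) (eq_pre1 (associK _ _ _)) comp_idl.
rewrite !(eq_pre1 (tensm_idl _ _ _)) Delta_epsl.
by rewrite tensm_id comp_idl.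
Qed.

Lemma coind_counit_colinear (M : RComodule D) :
  is_rcolinear ((Id ⊗m psi) ∘ coact M) (rcoact M) (coind_counit M).
Proof.
rewrite /is_rcolinear rcoact_coind_counit comp_assoc tensm_swap -comp_assoc.
by rewrite coind_counit_coact.
Qed.

(** * From (ii) to (iii) *)

Section Retract.
Variable chi : bicomod_hom (bicomod_self D) (bicomod_along psi).

Let chil : ((psi ⊗m Id) ∘ Delta A) ∘ chi = (Id ⊗m chi) ∘ Delta D.
Proof. exact: (bicomod_morPl chi). Qed.

Let chir : ((Id ⊗m psi) ∘ Delta A) ∘ chi = (chi ⊗m Id) ∘ Delta D.
Proof. exact: (bicomod_morPr chi). Qed.

(** Left colinearity of [chi] reduces this to coassociativity of the coaction of M. *)
Lemma coind_section_wd (M : RComodule D) :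
  cotens_l A (rcoact M) ∘ ((Id ⊗m chi) ∘ rcoact M)
  = cotens_r M (lcoact_along psi) ∘ ((Id ⊗m chi) ∘ rcoact M).
Proof.
rewrite /cotens_l /cotens_r /lcoact_along -!comp_assoc.
rewrite (eq_pre (tensm_swap _ _)) (eq_pre (assoc_natr _ _ _)).
rewrite (comp_assoc α) (proj1 (rcoactP M)).
by rewrite !(eq_pre1 (tensm_idl _ _ _)) chil.
Qed.

Definition coind_section (M : RComodule D) : Hom M (coind_ob E psi M) :=
  eq_lift (cotens_arrP E (rcoact M) (lcoact_along psi)) (coind_section_wd M).

Lemma coind_sectionE (M : RComodule D) :
  e M ∘ coind_section M = (Id ⊗m chi) ∘ rcoact M.
Proof. exact: eq_liftE. Qed.

(** By flatness [e M ⊗m Id] is mono, so the claim is tested in M ⊗ A ⊗ D, where it follows from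
    right colinearity of [chi] and coassociativity. *)
Lemma coind_section_colinear (M : RComodule D) :
  is_rcolinear (rcoact M) ((Id ⊗m psi) ∘ coact M) (coind_section M).
Proof.
rewrite /is_rcolinear.
apply: (is_equalizer_mono (coind_arr_tensP E C_flat psi M D)); apply: assoc_mono.
rewrite -!comp_assoc (eq_pre (tensm_swap _ _)) (eq_pre (assoc_natr _ _ _)).
have -> : assoc M A A ∘ ((e M ⊗m Id) ∘ (coact M ∘ coind_section M))
  = (Id ⊗m Delta A) ∘ ((Id ⊗m chi) ∘ rcoact M).
  by rewrite -coind_sectionE !comp_assoc -coact_arr !comp_assoc.
rewrite !(eq_pre1 (tensm_idl _ _ _)) chir (eq_pre1 (tensm_idr _ _ _)).
rewrite coind_sectionE -tensm_idr -comp_assoc (eq_pre (assoc_nat _ _ _)).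
by rewrite (comp_assoc α) (proj1 (rcoactP M)) -tensm_idl -!comp_assoc.
Qed.

Lemma coind_section_nat (M N : RComodule D) (f : rcomod_hom M N) :
  coind_map E psi f ∘ coind_section M = coind_section N ∘ f.
Proof.
apply: (is_equalizer_mono (cotens_arrP E (rcoact N) (lcoact_along psi))).
rewrite -/(coind_arr E psi N) !comp_assoc coind_mapE coind_sectionE -!comp_assoc.
by rewrite coind_sectionE rcomod_morP (eq_pre (tensm_swap _ _)).
Qed.

Lemma coind_counit_nat (M N : RComodule D) (f : rcomod_hom M N) :
  coind_counit N ∘ coind_map E psi f = f ∘ coind_counit M.
Proof.
rewrite /coind_counit -!comp_assoc coind_mapE -(eq_pre (tensm_swap _ _)).
by rewrite (eq_pre (runit_nat _)).
Qed.

(** An A-colinear [g] is D-colinear for the coactions pushed along [psi], so all three factors are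
    D-colinear. *)
Lemma coind_retract_colinear (M N : RComodule D) (g : Hom (F M) (F N)) :
  is_rcolinear (rcoact M) (rcoact N)
    (coind_counit N ∘ rcomod_mor g ∘ coind_section M).
Proof.
have Hg : is_rcolinear ((Id ⊗m psi) ∘ coact M) ((Id ⊗m psi) ∘ coact N)
    (rcomod_mor g).
  rewrite /is_rcolinear -comp_assoc [X in _ ∘ X](rcomod_morP g).
  by rewrite !comp_assoc tensm_swap.
apply: (is_rcolinear_comp _ (coind_section_colinear M)).
exact: is_rcolinear_comp (coind_counit_colinear N) Hg.
Qed.

Definition coind_retract (M N : rcomod_cat D) (g : Hom (F M) (F N)) : Hom M N :=
  @Build_rcomod_hom C D M N _ (coind_retract_colinear g).

Lemma coind_retract_natural : natural_hom_back coind_retract.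
Proof.
move=> M' M N N' h k g; apply: rcomod_hom_eq => /=.
rewrite -!comp_assoc coind_section_nat !comp_assoc coind_counit_nat.
by rewrite -!comp_assoc.
Qed.

Lemma coind_counit_section (M : RComodule D) :
  coind_counit M ∘ coind_section M
  = runit M ∘ ((Id ⊗m (eps A ∘ chi)) ∘ rcoact M).
Proof.
by rewrite /coind_counit -!comp_assoc coind_sectionE (eq_pre1 (tensm_idl _ _ _)).
Qed.

Lemma semiseparable_of_eps :
  eps A ∘ chi ∘ psi = eps A -> semiseparable F.
Proof.
move=> Hchi; exists coind_retract; split; first exact: coind_retract_natural.
move=> M N f; apply: rcomod_hom_eq.
apply: (is_equalizer_mono (cotens_arrP E (rcoact N) (lcoact_along psi))).
rewrite -/(coind_arr E psi N) [LHS]coind_mapE [RHS]coind_mapE /=.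
rewrite coind_counit_nat -comp_assoc coind_counit_section.
rewrite -!tensm_idr -triangle -!comp_assoc; congr (_ ∘ _).
(* The equalizer relation replaces the coaction of M by that of A, so [eps A ∘ chi] now meets [psi]
   and the hypothesis applies. *)
rewrite (eq_pre (assoc_nat _ _ _)) coind_arr_eq.
rewrite !(eq_pre1 (tensm_idl _ _ _)) /lcoact_along -(comp_assoc (lunit A)).
rewrite (eq_pre1 (tensm_idr _ _ _)).
by rewrite Hchi comp_assoc Delta_epsl tensm_id comp_idl.
Qed.

End Retract.

(** * From (iii) to (ii): D and A as right D-comodules, and their coinductions *)

Definition rcomod_self : RComodule D :=
  {| rcoact := Delta D; rcoactP := is_rcoaction_Delta D |}.
Definition rcomod_along : RComodule D :=
  {| rcoact := rcoact_along psi; rcoactP := rcoact_alongP psi |}.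

Definition rcomod_along_hom : rcomod_hom rcomod_along rcomod_self :=
  @Build_rcomod_hom C D rcomod_along rcomod_self psi (along_rcolinear psi).

Lemma coind_self_wd :
  cotens_l A (Delta D) ∘ lcoact_along psi
  = cotens_r D (lcoact_along psi) ∘ lcoact_along psi.
Proof. exact: (proj1 (lcoact_alongP psi)). Qed.

Definition coind_self : Hom A (coind_ob E psi rcomod_self) :=
  eq_lift (cotens_arrP E (Delta D) (lcoact_along psi)) coind_self_wd.

Lemma coind_selfE : e rcomod_self ∘ coind_self = lcoact_along psi.
Proof. exact: eq_liftE. Qed.

Definition coind_self_inv : Hom (coind_ob E psi rcomod_self) A :=
  lunit A ∘ (eps D ⊗m Id) ∘ e rcomod_self.

(** On D □ A the relation trades the coaction of A for Δ_D, whose first leg is then killed by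
    ε_D. *)
Lemma coind_self_invK : coind_self ∘ coind_self_inv = Id.
Proof.
apply: (is_equalizer_mono (cotens_arrP E (Delta D) (lcoact_along psi))).
rewrite comp_assoc [X in X ∘ _]coind_selfE comp_idr /coind_self_inv.
rewrite -(comp_assoc (lunit A)) -(eq_pre (lunit_nat _)) -(eq_pre (tensm_swap _ _)).
rewrite -(coind_arr_eq E psi rcomod_self) /= -(eq_pre (assoc_natl _ _ _)).
rewrite (eq_pre1 (lunit_tens _ _)) !(eq_pre1 (tensm_idr _ _ _)) Delta_epsl.
by rewrite tensm_id comp_idl.
Qed.

Lemma coind_selfK : coind_self_inv ∘ coind_self = Id.
Proof.
by rewrite /coind_self_inv -comp_assoc coind_selfE (proj2 (lcoact_alongP psi)).
Qed.

Lemma coind_self_inv_colinear :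
  is_rcolinear (coact rcomod_self) (Delta A) coind_self_inv.
Proof.
rewrite /is_rcolinear /coind_self_inv -!tensm_idr -!comp_assoc coind_coactE.
rewrite -!comp_assoc -(eq_pre (associ_natl _ _ _)) (eq_pre1 (lunit_associ _ _)).
by rewrite (eq_pre (tensm_swap _ _)) (eq_pre (lunit_nat _)).
Qed.

Lemma coind_Delta_wd :
  cotens_l A (rcoact_along psi) ∘ Delta A
  = cotens_r A (lcoact_along psi) ∘ Delta A.
Proof.
rewrite /cotens_l /cotens_r /rcoact_along /lcoact_along -tensm_idr -!comp_assoc.
by rewrite (eq_pre (assoc_nat _ _ _)) Delta_assoc' (eq_pre1 (tensm_idl _ _ _)).
Qed.

(** The unit, at the comodule A, of the adjunction between corestriction and coinduction. *)
Definition coind_Delta : Hom A (coind_ob E psi rcomod_along) :=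
  eq_lift (cotens_arrP E (rcoact_along psi) (lcoact_along psi)) coind_Delta_wd.

Lemma coind_DeltaE : e rcomod_along ∘ coind_Delta = Delta A.
Proof. exact: eq_liftE. Qed.

Lemma coind_Delta_colinear :
  is_rcolinear (Delta A) (coact rcomod_along) coind_Delta.
Proof.
apply: (is_equalizer_mono (coind_arr_tensP E C_flat psi rcomod_along A)).
apply: assoc_mono.
rewrite !comp_assoc -(comp_assoc α) coact_arr -!comp_assoc coind_DeltaE.
by rewrite (eq_pre1 (tensm_idr _ _ _)) coind_DeltaE Delta_assoc'.
Qed.

Definition coind_self_along : Hom (F rcomod_self) (F rcomod_along) :=
  @Build_rcomod_hom C A (coind_rcomod E C_flat psi rcomod_self)
    (coind_rcomod E C_flat psi rcomod_along) (coind_Delta ∘ coind_self_inv)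
    (is_rcolinear_comp coind_Delta_colinear coind_self_inv_colinear).

(** Hence F(ψ) composed with [coind_self_along] is the identity of D □ A. *)
Lemma coind_map_Delta :
  coind_map E psi rcomod_along_hom ∘ coind_Delta = coind_self.
Proof.
apply: (is_equalizer_mono (cotens_arrP E (Delta D) (lcoact_along psi))).
rewrite [RHS]coind_selfE comp_assoc.
rewrite [X in X ∘ _](coind_mapE E psi rcomod_along_hom) -comp_assoc.
by rewrite coind_DeltaE.
Qed.

Lemma dual_act_self_rcolinear (xi : Hom D unitob) :
  is_rcolinear (rcoact rcomod_self) (rcoact rcomod_self) (dual_act (Delta D) xi).
Proof. exact: dual_act_rcolinear (Delta_assoc' D). Qed.

Lemma dual_act_along_rcolinear (xi : Hom D unitob) :
  is_rcolinear (rcoact rcomod_along) (rcoact rcomod_along)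
    (dual_act (lcoact_along psi) xi).
Proof.
by apply: dual_act_rcolinear; rewrite comp_assoc; exact: bicoact_alongP.
Qed.

Definition dual_act_self (xi : Hom D unitob) : rcomod_hom rcomod_self rcomod_self :=
  Build_rcomod_hom (dual_act_self_rcolinear xi).
Definition dual_act_along (xi : Hom D unitob) :
    rcomod_hom rcomod_along rcomod_along :=
  Build_rcomod_hom (dual_act_along_rcolinear xi).

Lemma dual_act_along_Delta (xi : Hom D unitob) :
  is_rcolinear (Delta A) (Delta A) (dual_act (lcoact_along psi) xi).
Proof. exact: dual_act_rcolinear (lcoact_along_Delta psi). Qed.

(** The action on A is right A-colinear, hence passes through Δ_A to the first leg, where [psi],
    being left colinear, commutes with it. *)
Lemma coind_self_dual_act (xi : Hom D unitob) :
  coind_map E psi (dual_act_self xi) ∘ coind_self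
  = coind_self ∘ dual_act (lcoact_along psi) xi.
Proof.
apply: (is_equalizer_mono (cotens_arrP E (Delta D) (lcoact_along psi))).
rewrite [LHS]comp_assoc [RHS]comp_assoc [X in _ = X ∘ _]coind_selfE.
rewrite [X in X ∘ _](coind_mapE E psi (dual_act_self xi)).
rewrite -comp_assoc coind_selfE /= {1 3}/lcoact_along -comp_assoc.
rewrite dual_act_along_Delta !(eq_pre1 (tensm_idr _ _ _)).
by rewrite (dual_act_nat _ (along_lcolinear psi)).
Qed.

Lemma coind_Delta_dual_act (xi : Hom D unitob) :
  coind_map E psi (dual_act_along xi) ∘ coind_Delta
  = coind_Delta ∘ dual_act (lcoact_along psi) xi.
Proof.
apply: (is_equalizer_mono (cotens_arrP E (rcoact_along psi) (lcoact_along psi))).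
rewrite [LHS]comp_assoc [RHS]comp_assoc [X in _ = X ∘ _]coind_DeltaE.
rewrite [X in X ∘ _](coind_mapE E psi (dual_act_along xi)).
by rewrite -comp_assoc coind_DeltaE dual_act_along_Delta.
Qed.

(** Both coinduced actions correspond to the action on A itself, through [coind_self] and
    [coind_Delta]. *)
Lemma coind_self_along_dual_act (xi : Hom D unitob) :
  fmap F (dual_act_along xi : @Hom (rcomod_cat D) _ _) ∘ coind_self_along
  = coind_self_along ∘ fmap F (dual_act_self xi : @Hom (rcomod_cat D) _ _).
Proof.
apply: rcomod_hom_eq => /=.
rewrite comp_assoc coind_Delta_dual_act -[LHS]comp_assoc -[RHS]comp_assoc.
congr (_ ∘ _); rewrite -[RHS]comp_idr -coind_self_invK -[RHS]comp_assoc.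
by rewrite (eq_pre (coind_self_dual_act xi)) (eq_pre1 coind_selfK) comp_idl.
Qed.

Lemma eps_of_semiseparable :
  left_tensor_cogenerator (@unitob C) -> semiseparable F ->
  exists chi : bicomod_hom (bicomod_self D) (bicomod_along psi),
    eps A ∘ chi ∘ psi = eps A.
Proof.
move=> Hcog [P [Pnat PF]].
pose chi : @Hom (rcomod_cat D) rcomod_self rcomod_along := P _ _ coind_self_along.
have chil : is_lcolinear (Delta D) (lcoact_along psi) (rcomod_mor chi).
  apply: lcolinear_of_dual_act => // xi.
  (* Naturality in the target and in the source turns the commutation of [coind_self_along] with the
     actions into that of [chi]. *)
  have H1 := Pnat _ _ _ _ (idm (rcomod_self : rcomod_cat D))
    (dual_act_along xi : @Hom (rcomod_cat D) _ _) coind_self_along.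
  have H2 := Pnat _ _ _ _ (dual_act_self xi : @Hom (rcomod_cat D) _ _)
    (idm (rcomod_along : rcomod_cat D)) coind_self_along.
  rewrite !fmap_id !comp_idr in H1; rewrite !fmap_id !comp_idl in H2.
  rewrite coind_self_along_dual_act H2 in H1.
  by have /= := f_equal (@rcomod_mor _ _ _ _) H1.
exists (@Build_bicomod_hom _ _ _ (bicomod_self D) (bicomod_along psi) _ chil
  (rcomod_morP chi)) => /=.
have psichi : (rcomod_along_hom : @Hom (rcomod_cat D) _ _) ∘ chi = P _ _ (fmap F Id).
  have := Pnat _ _ _ _ (idm (rcomod_self : rcomod_cat D))
    (rcomod_along_hom : @Hom (rcomod_cat D) _ _) coind_self_along.
  rewrite fmap_id !comp_idr => <-; congr (P _ _ _); apply: rcomod_hom_eq => /=.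
  by rewrite comp_assoc coind_map_Delta coind_self_invK.
(* Semiseparability at the identity of D gives F(ψχ) = Id. *)
have := PF _ _ (idm (rcomod_self : rcomod_cat D)); rewrite -psichi fmap_id => H.
have {}H := f_equal (@rcomod_mor _ _ _ _) H; rewrite /= in H.
have HD : lcoact_along psi = ((psi ∘ rcomod_mor chi) ⊗m Id) ∘ lcoact_along psi.
  rewrite -{1}coind_selfE -(comp_idl coind_self) -H comp_assoc.
  by rewrite [X in X ∘ _]coind_mapE -comp_assoc coind_selfE.
(* Applying ε_A to the second leg of (ψ ⊗ Id)Δ_A recovers ψ, so ψ = ψχψ; composing with ε_D
   finishes. *)
have {}HD := f_equal (fun h => runit D ∘ ((Id ⊗m eps A) ∘ h)) HD.
rewrite /= /lcoact_along -!(eq_pre (tensm_swap _ (eps A))) in HD.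
rewrite !(eq_pre (runit_nat _)) (comp_assoc (runit A)) Delta_epsr comp_idr in HD.
by rewrite -(coalg_mor_eps psi) -!comp_assoc; congr (_ ∘ _); rewrite comp_assoc -HD.
Qed.

End Semiseparable.

Theorem theorem4p4 (C : MonoidalCategory) (E : Equalizers C)
    (C_flat : forall X : C, flat X)
    (A D : Coalgebra C) (psi : coalg_hom A D) :
  let cond_i :=
    @regular (bicomod_cat D D) (bicomod_along psi) (bicomod_self D)
      (bicomod_along_hom psi) in
  let cond_ii :=
    exists chi : bicomod_hom (bicomod_self D) (bicomod_along psi),
      comp (comp (eps A) (bicomod_mor chi)) (coalg_mor psi) = eps A in
  let cond_iii := semiseparable (coinduction E C_flat psi) in
  (cond_i <-> cond_ii) /\
  (cond_i \/ cond_ii -> cond_iii) /\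
  (left_tensor_cogenerator (@unitob C) ->
     (cond_iii <-> cond_i) /\ (cond_iii <-> cond_ii)).
Proof.
move=> ci cii ciii.
have Hi : ci <-> cii := regular_iff_eps psi.
have Hii : cii -> ciii by case=> chi; exact: semiseparable_of_eps.
split=> //; split; first by case=> [/Hi|] /Hii.
move=> Hcog; have Hiii : ciii -> cii := eps_of_semiseparable Hcog.
by split; split=> // [/Hiii/Hi|/Hi/Hii].
Qed.
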